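(* Let $\mathbb{F}_q$ be a finite field with $q$ elements, let $V$ be an $\mathbb{F}_q$-vector space of finite dimension $n\ge 1$, and let $G$ be a group acting linearly on $V$. Let $\underline{a}=(a_1,\dots,a_r)$ and $\underline{b}=(b_1,\dots,b_r)$ be two compositions of $n$ such that $P(\underline{a})\ge P(\underline{b})$ for the dominance order. Then $$N(G,\mathrm{Fl}_{\underline{a}}(V))\le N(G,\mathrm{Fl}_{\underline{b}}(V)).$$
   Context: A composition of $n$ of length $r$ ($r\ge 1$) is an $r$-tuple $(a_1,\dots,a_r)$ of nonnegative integers with $a_1+\dots+a_r=n$. A partition of $n$ of length $r$ is a composition $(\lambda_1,\dots,\lambda_r)$ of $n$ with $\lambda_1\ge\dots\ge\lambda_r\ge 0$. For a composition $\underline{a}=(a_1,\dots,a_r)$ of $n$, $P(\underline{a})$ is the partition of $n$ obtained by rearranging the terms of $\underline{a}$ in weakly decreasing order. Dominance order: for partitions $\lambda=(\lambda_1,\dots,\lambda_r)$ and $\mu=(\mu_1,\dots,\mu_r)$ of $n$, $\lambda\ge\mu$ means $\lambda_1+\dots+\lambda_i\ge\mu_1+\dots+\mu_i$ for every $i\in\{1,\dots,r\}$. For a composition $(a_1,\dots,a_r)$ of $n$, $\mathrm{Fl}_{(a_1,\dots,a_r)}(V)$ is the (finite) set of flags $0=V_0\subset V_1\subset\dots\subset V_r=V$ of $\mathbb{F}_q$-linear subspaces of $V$ with $\dim V_i/V_{i-1}=a_i$ for all $i$. The action of $G$ on $V$ induces an action of $G$ on it. For a group $G$ acting on a finite set $E$,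 $N(G,E)$ is the number of orbits. *)

(* Defs.v *)
From HB Require Import structures.
From mathcomp Require Import all_boot all_order all_algebra.
From mathcomp Require Import boolp.

Set Implicit Arguments.
Unset Strict Implicit.
Unset Printing Implicit Defensive.

(* Finiteness of {vspace V} over a finite field comes from its matrix encoding,
   which the vector library does not export by default. *)
Import VectorInternalTheory.
HB.instance Definition _ (F : finFieldType) (V : vectType F) :=
  [Countable of {vspace V} by <:].
HB.instance Definition _ (F : finFieldType) (V : vectType F) :=
  [Finite of {vspace V} by <:].

Definition composition (n r : nat) (a : r.-tuple nat) : Prop := sumn a = n.

Definition partition_of (r : nat) (a : r.-tuple nat) : r.-tuple nat :=
  sort_tuple geq a.

Definition dominates (r : nat) (lambda mu : r.-tuple nat) : Prop :=
  forall i : nat, 1 <= i <= r -> sumn (take i mu) <= sumn (take i lambda).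

Section Orbits.
Variables (G : groupType) (T : finType) (act : G -> T -> T).

(* G may be infinite, so membership in an orbit is decided classically. *)
Definition orbit_of (x : T) : {set T} := [set y | `[< exists g, act g x = y >]].

Definition num_orbits (E : {set T}) : nat := #|[set orbit_of x | x in E]|.

End Orbits.

Section Flags.
Variables (F : finFieldType) (V : vectType F).

Definition linear_action (G : groupType) (rho : G -> 'End(V)) : Prop :=
  rho 1%g = \1%VF /\ forall g h, rho (g * h)%g = (rho g \o rho h)%VF.

(* The consecutive terms of W are V_0, ..., V_r. *)
Definition Fl (r : nat) (a : r.-tuple nat) : {set r.+1.-tuple {vspace V}} :=
  [set W : r.+1.-tuple {vspace V} |
    [&& nth 0%VS W 0 == 0%VS,
        nth 0%VS W r == fullv &
        [forall i : 'I_r,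
          (nth 0%VS W i <= nth 0%VS W i.+1)%VS &&
          (\dim (nth 0%VS W i.+1) == \dim (nth 0%VS W i) + tnth a i)]]].

Definition flag_act (G : groupType) (rho : G -> 'End(V)) (r : nat)
    (g : G) (W : r.+1.-tuple {vspace V}) : r.+1.-tuple {vspace V} :=
  map_tuple (fun U => rho g @: U)%VS W.

End Flags.

(* Main.v *)
Require Import Defs.
From HB Require Import structures.
From mathcomp Require Import all_boot all_order all_algebra.
From mathcomp Require Import boolp zify.

(** Two ideas carry the proof.

    Linear algebra replaces counting.  Suppose [G] acts on finite sets [E] and
    [E'], and an invariant relation between them has an incidence matrix that
    is injective on the rational functions on [E].  Restricted to the
    [G]-invariant functions, whose dimension is the number of orbits, this
    matrix is still injective, so [E] has at most as many orbits as [E']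
    ([leq_num_orbits]).

    Combinatorics reduces the theorem to compositions that differ in two
    adjacent terms: if [P(a)] dominates [P(b)], then [b] is reached from [a] by
    moves that replace adjacent terms [x, y] by [x', y'] with the same sum and
    [min x y <= min x' y'] ([dominates_smoothing]).  Such a move may swap two
    terms, or bring them closer.

    For one such move, flags of types [a] and [b] are related when they agree
    except at the term [V_i] between the two positions, and there one contains
    the other.  With [A = V_(i-1)] and [B = V_(i+1)] fixed, what remains is the
    incidence matrix between the subspaces of dimension [k] and those of
    dimension [l] in the interval [[A, B]].  It is injective by a theorem of
    Kantor, used here both for [k <= l] and [k + l <= dim A + dim B]
    ([kantor_up]) and in the dual case ([kantor_down]).

    To prove Kantor's theorem, let [f] be in the kernel and fix [T] of
    dimension [k].  The stabilizer of [A], [B] and [T] in [GL(V)] is transitive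
    on the subspaces [X] with a given value of [dim (X :&: T)]
    ([move_subspace]), so sums of [f] over these classes satisfy a linear
    system.  The system is triangular with nonzero diagonal, hence all the sums
    vanish ([triangular_sums_eq0]); the class of [T] is [{T}], hence
    [f T = 0]. *)

Set Implicit Arguments.
Unset Strict Implicit.
Unset Printing Implicit Defensive.
Import GRing.Theory Num.Theory.

(** * Dominance and adjacent smoothing moves *)

(** [smoothing s t]: [t] is obtained from [s] by finitely many moves, each
    replacing two adjacent terms by two terms with the same sum and at least
    the same minimum. *)
Inductive smoothing : seq nat -> seq nat -> Prop :=
| smoothing_refl s : smoothing s s
| smoothing_step p x y x' y' q t :
    x + y = x' + y' -> minn x y <= minn x' y' ->
    smoothing (p ++ x' :: y' :: q) t -> smoothing (p ++ x :: y :: q) t.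

Lemma smoothing_trans s t u : smoothing s t -> smoothing t u -> smoothing s u.
Proof.
elim=> // p x y x' y' q v exy hm _ IH /IH.
exact: smoothing_step.
Qed.

Lemma smoothing_cons z s t : smoothing s t -> smoothing (z :: s) (z :: t).
Proof.
elim=> [{}s|p x y x' y' q {}t exy hm _ IH]; first exact: smoothing_refl.
by rewrite -cat_cons; apply: smoothing_step hm _.
Qed.

(** A swap of two adjacent terms is a move, so a term can be moved anywhere. *)
Lemma smoothing_insert x s t : smoothing (x :: s ++ t) (s ++ x :: t).
Proof.
elim: s => [|y s IH] /=; first exact: smoothing_refl.
apply: (@smoothing_step [::] x y y x); rewrite ?[y + x]addnC // 1?minnC //.
exact: smoothing_cons.
Qed.

Lemma perm_smoothing s t : perm_eq s t -> smoothing s t.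
Proof.
elim: s t => [|x s IH] t pst.
  by move: pst; rewrite perm_sym => /perm_nilP ->; apply: smoothing_refl.
have xt : x \in t by rewrite -(perm_mem pst) mem_head.
case/splitPr: xt pst => t1 t2 pst.
apply: smoothing_trans (smoothing_insert x t1 t2).
apply/smoothing_cons/IH.
by move: pst; rewrite perm_sym perm_catC /= perm_cons perm_catC perm_sym.
Qed.

(** [carry_dom c s t]: [s] and [t] have the same length, every prefix sum of
    [s] plus the carry [c] is at least that of [t], with equality for the total
    sums.  No monotonicity of [s] or [t] is required. *)
Fixpoint carry_dom c (s t : seq nat) :=
  match s, t with
  | x :: s', y :: t' => (y <= c + x) && carry_dom (c + x - y) s' t'
  | [::], [::] => c == 0
  | _, _ => false
  end.

Lemma carry_domP c s t : size s = size t -> c + sumn s = sumn t ->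
  (forall i, i <= size t -> sumn (take i t) <= c + sumn (take i s)) ->
  carry_dom c s t.
Proof.
elim: s t c => [|x s IH] [|y t] c //=; first by lia.
move=> [sz] esum dom.
have le1 : y <= c + x by have := dom 1 isT; rewrite /= !take0 /=; lia.
rewrite le1 IH //; first by lia.
by move=> i /(dom i.+1) /=; lia.
Qed.

(** One unit of the carry can be spent on a term of [s] smaller than [y]: the
    first term of [s] that is smaller than the corresponding term of [t]. *)
Lemma carry_dom_raise c y s t : all (fun w => w <= y) t -> carry_dom c.+1 s t ->
  exists p z q, [/\ s = p ++ z :: q, z < y & carry_dom c (p ++ z.+1 :: q) t].
Proof.
elim: s t c => [|x s IH] [|w t] c //= /andP[wy ally] /andP[wcx dom].
have [ltxw|lewx] := ltnP x w.
  exists [::], x, s; split=> //=; first by lia.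
  by rewrite addnS -addSn wcx.
have [|p [z [q [-> zy domq]]]] := IH t (c + x - w) ally.
  by rewrite -subSn -?addSn; lia.
exists (x :: p), z, q; split=> //=.
by rewrite domq andbT; lia.
Qed.

(** The head [x] of [s] is lowered to the head [y] of [t] one unit at a time,
    each unit being moved to a term smaller than [y]. *)
Lemma carry_dom_smoothing s t :
  sorted geq t -> carry_dom 0 s t -> smoothing s t.
Proof.
elim: t s => [|y t IH] [|x s] //= st; first by move=> _; apply: smoothing_refl.
have ally : all (fun w => w <= y) t.
  by apply: order_path_min st => a b c /= ba cb; apply: leq_trans cb ba.
have {IH} IH := IH _ (path_sorted st).
rewrite !add0n => /andP[leyx].
have [d ->] : exists d, x = d + y by exists (x - y); rewrite subnK.
rewrite addnK; elim: d s => [|d IHd] s dom.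
  by apply/smoothing_cons/IH.
have [p [z [q [-> zy domq]]]] := carry_dom_raise ally dom.
apply: smoothing_trans (IHd _ domq).
(* The receiving term is brought next to the head, raised, and put back. *)
apply: (@smoothing_trans _ (d.+1 + y :: z :: p ++ q)).
  by apply: perm_smoothing; rewrite perm_cons perm_catC /= perm_cons perm_catC.
apply: (@smoothing_step [::] _ _ (d + y) z.+1); try lia.
exact/smoothing_cons/smoothing_insert.
Qed.

Lemma dominates_smoothing n r (a b : r.-tuple nat) :
  composition n a -> composition n b ->
  dominates (partition_of a) (partition_of b) -> smoothing a b.
Proof.
move=> ha hb dom.
have sumn_sort (s : seq nat) : sumn (sort geq s) = sumn s.
  by apply/perm_sumn; rewrite perm_sort.
apply: (@smoothing_trans _ (sort geq a)).
  by apply: perm_smoothing; rewrite perm_sym perm_sort.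
apply: (@smoothing_trans _ (sort geq b)); last first.
  by apply: perm_smoothing; rewrite perm_sort.
apply: carry_dom_smoothing.
  by apply: sort_sorted => x y; apply: leq_total.
apply: carry_domP.
- by rewrite !size_sort !size_tuple.
- by rewrite !sumn_sort ha hb.
- move=> [|i]; rewrite ?take0 // size_sort size_tuple => ir.
  exact: dom.
Qed.

(** * Orbit counts and incidence matrices *)

Section Orbits.
Variables (G : groupType) (T : finType) (act : G -> T -> T).
Hypothesis act1 : forall x, act 1%g x = x.
Hypothesis actM : forall g h x, act (g * h)%g x = act g (act h x).

Lemma orbit_refl x : x \in orbit_of act x.
Proof. by rewrite inE; apply/asboolP; exists 1%g. Qed.

Lemma actVK g : cancel (act g) (act g^-1%g).
Proof. by move=> x; rewrite -actM mulVg act1. Qed.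

Lemma orbit_eq x y : y \in orbit_of act x -> orbit_of act y = orbit_of act x.
Proof.
rewrite inE => /asboolP[g <-]; apply/setP => z; rewrite !inE.
apply/asboolP/asboolP => -[h <-]; first by exists (h * g)%g; rewrite actM.
by exists (h * g^-1)%g; rewrite actM actVK.
Qed.

(** An invariant relation [R] whose incidence matrix is injective on rational
    functions on [E] bounds the number of orbits of [E] by that of [E'].  It
    suffices to look at the matrix [M] between orbits that it induces on
    invariant functions: injectivity makes [M] row free. *)
Lemma leq_num_orbits (E E' : {set T}) (R : rel T) :
  (forall g x, x \in E -> act g x \in E) ->
  (forall g x y, R x y -> R (act g x) (act g y)) ->
  (forall f : T -> rat,
     (forall y, y \in E' -> \sum_(x in E | R x y) f x = 0)%R ->
     forall x, x \in E -> f x = 0%R) ->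
  num_orbits act E <= num_orbits act E'.
Proof.
move=> Estab Rinv injR; rewrite /num_orbits.
set O := imset _ _; set O' := imset _ _.
have /fin_all_exists2 [x xE Ox] (i : 'I_#|O|) :
    exists2 x, x \in E & enum_val i = orbit_of act x.
  exact/imsetP/enum_valP.
have /fin_all_exists2 [y yE' Oy] (j : 'I_#|O'|) :
    exists2 y, y \in E' & enum_val j = orbit_of act y.
  exact/imsetP/enum_valP.
pose M := (\matrix_(i < #|O|, j < #|O'|)
  \sum_(z in E | R z (y j) && (z \in enum_val i)) (1 : rat))%R.
suff /eqP <- : row_free M by apply: rank_leq_col.
apply: inj_row_free => u uM0.
(* [f] is the invariant function on [E] with value [u i] on the orbit [i]. *)
pose f z := (\sum_(i < #|O| | z \in enum_val i) u ord0 i)%R.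
have f_act g z : f (act g z) = f z.
  apply: eq_bigl => i; rewrite Ox.
  have aux h w : w \in orbit_of act (x i) -> act h w \in orbit_of act (x i).
    rewrite !inE => /asboolP[k <-]; apply/asboolP.
    by exists (h * k)%g; rewrite actM.
  by apply/idP/idP=> /aux; [move/(_ g^-1%g); rewrite actVK | apply].
have f0 : forall z, z \in E -> f z = 0%R.
  apply: injR => w wE'.
  have : orbit_of act w \in O' by apply: imset_f.
  move=> wO; pose j := enum_rank_in wO (orbit_of act w).
  have : w \in enum_val j by rewrite enum_rankK_in // orbit_refl.
  rewrite Oy inE => /asboolP[g <-].
  rewrite (reindex_inj (can_inj (actVK g))) /=.
  transitivity (\sum_(z in E | R z (y j)) f z)%R.
    apply: eq_big => [z|z _]; last exact: f_act.
    congr (_ && _); apply/idP/idP.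
    - by move/(Estab g^-1%g); rewrite actVK.
    - exact: Estab.
    - by move/(Rinv g^-1%g); rewrite !actVK.
    - exact: Rinv.
  have uMj : (u *m M)%R ord0 j = 0%R by rewrite uM0 mxE.
  rewrite -[RHS]uMj mxE /f (exchange_big_dep xpredT) //=; apply: eq_bigr => i _.
  rewrite mxE mulr_sumr; apply: eq_big => z; first by rewrite andbA.
  by rewrite mulr1.
apply/rowP=> i; rewrite mxE -(f0 (x i) (xE i)) /f (big_pred1 i) // => i'.
apply/idP/eqP => [|<-]; last by rewrite Ox orbit_refl.
by rewrite Ox => /orbit_eq; rewrite -!Ox => /enum_val_inj.
Qed.

End Orbits.

(** Let [f] on [P] have zero sum over the neighbours of every [Y] in [Q].
    Neighbours satisfy [tau X <= sigma Y], equality is attained for every [X],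
    and the number of neighbours of [X] at each level of [sigma] depends only on
    [tau X].  Then [f] has zero sum on every level of [tau]: summing the
    hypothesis over the [Y] at level [j] gives a relation between the levels
    [i <= j] in which level [j] has a positive coefficient. *)
Lemma triangular_sums_eq0 (S : finType) (P Q : pred S) (R : rel S)
    (tau sigma : S -> nat) (f : S -> rat) :
  (forall X Y, P X -> Q Y -> R X Y -> tau X <= sigma Y) ->
  (forall X, P X -> exists Y, [/\ Q Y, R X Y & sigma Y = tau X]) ->
  (forall X X' j, P X -> P X' -> tau X = tau X' ->
     #|[set Y | [&& Q Y, sigma Y == j & R X Y]]| =
     #|[set Y | [&& Q Y, sigma Y == j & R X' Y]]|) ->
  (forall Y, Q Y -> \sum_(X | P X && R X Y) f X = 0)%R ->
  forall j, (\sum_(X | P X && (tau X == j)) f X = 0)%R.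
Proof.
move=> mono exY cst f0; elim/ltn_ind => j IH.
pose c X := #|[set Y | [&& Q Y, sigma Y == j & R X Y]]|.
have [X0 /andP[PX0 /eqP tX0]|noX] := pickP (fun X => P X && (tau X == j)); last first.
  by rewrite big_pred0.
have cX0 : c X0 != 0.
  have [Y [QY RY sY]] := exY _ PX0.
  by rewrite -lt0n; apply/card_gt0P; exists Y; rewrite inE QY RY sY tX0 eqxx.
have sum_cf : (\sum_(X | P X) f X *+ c X = 0)%R.
  transitivity (\sum_(Y | Q Y && (sigma Y == j)) \sum_(X | P X && R X Y) f X)%R.
    rewrite (exchange_big_dep P) /=; last by move=> ? ? _ /andP[].
    apply: eq_bigr => X PX; rewrite sumr_const; congr (_ *+ _)%R.
    by apply: eq_card => Y; rewrite !inE PX /= andbA.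
  by rewrite big1 // => Y /andP[QY _]; apply: f0.
have level i X1 : P X1 -> tau X1 = i -> (\sum_(X | P X && (tau X == i)) f X *+ c X
   = (\sum_(X | P X && (tau X == i)) f X) *+ c X1)%R.
  move=> PX1 tX1; rewrite -sumrMnl; apply: eq_bigr => X /andP[PX /eqP tX].
  by congr (_ *+ _)%R; apply: cst => //; rewrite tX.
apply/eqP; suff : ((\sum_(X | P X && (tau X == j)) f X) *+ c X0 == 0)%R.
  by rewrite mulrn_eq0 (negPf cX0).
rewrite -(level j) //; apply/eqP; rewrite -[RHS]sum_cf.
(* [partition_big] needs a finite type of levels, hence the bounded [inord]. *)
pose N := \max_(X | P X) tau X.
rewrite [RHS](partition_big (fun X => inord (tau X) : 'I_N.+1) xpredT) //=.
have bnd X : P X -> tau X < N.+1.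
  by move=> PX; rewrite ltnS leq_bigmax_cond.
rewrite [RHS](bigD1 (inord j)) //= [X in (_ + X)%R]big1 ?addr0 => [|i ineq].
  apply: eq_bigl => X; case PX: (P X) => //=.
  by rewrite -!val_eqE /= !inordK ?bnd // -tX0 bnd.
have eqi X : P X && (inord (tau X) == i) = P X && (tau X == i).
  by case PX: (P X) => //=; rewrite -val_eqE /= inordK ?bnd.
under eq_bigl do rewrite eqi.
have [ltij|leji] := ltnP i j.
  have [X1 /andP[PX1 /eqP tX1]|noX] := pickP (fun X => P X && (tau X == i)); last first.
    by rewrite big_pred0.
  by rewrite (level _ X1) // IH // mul0rn.
have {ineq leji} ltji : j < i.
  rewrite ltn_neqAle leji andbT; apply: contraNneq ineq => e.
  by rewrite -val_eqE /= inordK ?e // -e -tX0 bnd.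
rewrite big1 // => X /andP[PX /eqP tX].
rewrite (_ : c X = 0) ?mulr0n //; apply/eqP; rewrite cards_eq0.
apply/eqP/setP=> Y; rewrite !inE; apply/negP => /and3P[QY /eqP sY RXY].
by have := mono _ _ PX QY RXY; rewrite sY tX leqNgt ltji.
Qed.

(** * Subspaces and linear automorphisms *)

Section Subspaces.
Variables (F : fieldType) (V : vectType F).
Implicit Types (A B D T U W X Y : {vspace V}) (g : 'End(V)).

Lemma cap_diffv U W : (U :&: (W :\: U) = 0)%VS.
Proof. by rewrite capvC; apply: capv_diff. Qed.

Lemma addv_diff_sub U W : (U <= W)%VS -> (U + (W :\: U) = W)%VS.
Proof. by move=> UW; rewrite addvC addv_diff; apply/addv_idPl. Qed.

Lemma dimv_diff U W : (U <= W)%VS -> \dim (W :\: U) = \dim W - \dim U.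
Proof.
move=> UW; rewrite -[in RHS](addv_diff_sub UW).
by rewrite (dimv_disjoint_sum (cap_diffv _ _)) addKn.
Qed.

Lemma subspace_between U W m : (U <= W)%VS -> \dim U <= m <= \dim W ->
  exists Y, [/\ (U <= Y)%VS, (Y <= W)%VS & \dim Y = m].
Proof.
move=> UW /andP[Um mW].
pose s := vbasis (W :\: U); pose K := <<take (m - \dim U) s>>%VS.
have KW : (K <= W :\: U)%VS.
  rewrite -[X in (_ <= X)%VS](span_basis (vbasisP _)).
  by apply: sub_span => v; apply: mem_take.
exists (U + K)%VS; split; first exact: addvSl.
  by rewrite -(addv_diff_sub UW) addvS.
rewrite dimv_disjoint_sum; last first.
  by apply/eqP; rewrite -subv0 -(cap_diffv U W) capvS.
have : free (take (m - \dim U) s).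
  have := basis_free (vbasisP (W :\: U)).
  by rewrite -[X in free X](cat_take_drop (m - \dim U) s) => /catl_free.
move/eqP=> ->; rewrite size_takel ?subnKC // size_tuple dimv_diff //.
exact: leq_sub2r.
Qed.

Lemma eq_dim_limg U W : \dim U = \dim W -> exists g, (g @: U = W)%VS.
Proof.
move=> eUW; have [f] := linear_of_free (vbasis U) (vbasis W).
move=> /(_ (basis_free (vbasisP U))); rewrite !size_tuple => /(_ (esym eUW)) fE.
exists (linfun f).
rewrite -{1}(span_basis (vbasisP U)) limg_span -(span_basis (vbasisP W)) -fE.
by congr span; apply: eq_map => v; rewrite lfunE.
Qed.

(** Linear maps that agree on [U :&: W] extend to a common linear map. *)
Lemma glue_lfun U W g1 g2 : {in (U :&: W)%VS, g1 =1 g2} ->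
  exists g, {in U, g =1 g1} /\ {in W, g =1 g2}.
Proof.
move=> e12; pose C := (W :\: U)%VS.
have UC : (U :&: C = 0)%VS by apply: cap_diffv.
have CU : (C :&: U = 0)%VS by apply: capv_diff.
have pi0 (P Q : {vspace V}) v : (P :&: Q = 0)%VS -> v \in P -> daddv_pi Q P v = 0%R.
  move=> PQ vP; have vPQ : v \in (P + Q)%VS by apply: subvP vP; apply: addvSl.
  apply: (addrI v); rewrite addr0 -[in LHS](daddv_pi_id PQ vP).
  by rewrite -[in RHS](daddv_pi_add PQ vPQ) (daddv_pi_id PQ vP).
pose g := ((g1 \o daddv_pi U C)%VF + (g2 \o daddv_pi C U)%VF)%R.
have gE u c : u \in U -> c \in C -> g (u + c)%R = (g1 u + g2 c)%R.
  move=> uU cC; rewrite add_lfunE !comp_lfunE !linearD /=.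
  rewrite (daddv_pi_id UC uU) (daddv_pi_id CU cC) (pi0 _ _ _ UC uU) (pi0 _ _ _ CU cC).
  by rewrite !linear0 addr0 add0r.
have gU : {in U, g =1 g1}.
  by move=> u uU; rewrite -[u in LHS]addr0 gE ?mem0v // linear0 addr0.
exists g; split=> // w wW.
have /memv_addP[c cC [u uI ->]] : w \in (C + W :&: U)%VS.
  by rewrite addv_diff_cap.
have /andP[uW uU] : (u \in W) && (u \in U) by rewrite -memv_cap.
by rewrite addrC gE // linearD /= e12 // memv_cap uU.
Qed.

Lemma extend_lfun U W U' W' g : (U <= W)%VS -> (U' <= W')%VS ->
  (g @: U = U')%VS -> \dim U = \dim U' -> \dim W = \dim W' ->
  exists2 h : 'End(V), {in U, h =1 g} & (h @: W = W')%VS.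
Proof.
move=> UW UW' gU eU eW.
have [|k kC] := @eq_dim_limg (W :\: U) (W' :\: U')%VS.
  by rewrite !dimv_diff // eU eW.
have [|h [hg hk]] := @glue_lfun U (W :\: U)%VS g k.
  by move=> v; rewrite cap_diffv memv0 => /eqP->; rewrite !linear0.
exists h => //; rewrite -(addv_diff_sub UW) limgD.
by rewrite (eq_in_limg hg) (eq_in_limg hk) gU kC addv_diff_sub.
Qed.

Lemma lker0_of_limgf g : (g @: fullv = fullv)%VS -> lker g == 0%VS.
Proof.
move=> gf; rewrite -dimv_eq0; have := limg_ker_dim g fullv.
by rewrite gf capfv; lia.
Qed.

(** Transitivity of the stabilizer of [A], [B] and [T] on the subspaces [X]
    with [A <= X :&: T], [X + T <= B], and fixed dimensions of [X] and
    [X :&: T].  The automorphism is built up along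
    [A <= X :&: T <= X, T <= X + T <= B <= V]. *)
Lemma move_subspace A B T X X' :
  (A <= X :&: T)%VS -> (A <= X' :&: T)%VS -> (X + T <= B)%VS -> (X' + T <= B)%VS ->
  \dim X = \dim X' -> \dim (X :&: T) = \dim (X' :&: T) ->
  exists g, [/\ lker g == 0%VS, (g @: A = A)%VS, (g @: B = B)%VS,
    (g @: T = T)%VS & (g @: X = X')%VS].
Proof.
move=> AD AD' SB SB' eX eD.
have [gD gDA gDE] := extend_lfun AD AD' (lim1g A) erefl eD.
have [gX gXD gXE] := extend_lfun (capvSl X T) (capvSl X' T) gDE eD eX.
have [gT gTD gTE] := extend_lfun (capvSr X T) (capvSr X' T) gDE eD erefl.
have [|gS [gSX gST]] := @glue_lfun X T gX gT.
  by move=> v vD; rewrite gXD ?gTD.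
have gSE : (gS @: (X + T) = X' + T)%VS.
  by rewrite limgD (eq_in_limg gSX) (eq_in_limg gST) gXE gTE.
have eS : \dim (X + T) = \dim (X' + T).
  by have := dimv_sum_cap X T; have := dimv_sum_cap X' T; lia.
have [gB gBS gBE] := extend_lfun SB SB' gSE eS erefl.
have [g gB' gE] := extend_lfun (subvf B) (subvf B) gBE erefl erefl.
have onS : {in (X + T)%VS, g =1 gS}.
  by move=> v vS; rewrite gB' ?gBS //; apply: subvP vS.
have onX : {in X, g =1 gX}.
  by move=> v vX; rewrite onS ?gSX //; apply: subvP vX; apply: addvSl.
have onT : {in T, g =1 gT}.
  by move=> v vT; rewrite onS ?gST //; apply: subvP vT; apply: addvSr.
exists g; split; first exact: lker0_of_limgf.
- rewrite -[RHS]lim1g; apply: eq_in_limg => v vA.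
  have vD := subvP AD _ vA.
  rewrite onX ?gXD ?gDA //; apply: subvP vD; exact: capvSl.
- by rewrite (eq_in_limg gB').
- by rewrite (eq_in_limg onT).
- by rewrite (eq_in_limg onX).
Qed.
End Subspaces.

(** * Injectivity of the incidence matrices of subspaces *)

Section Kantor.
Variables (F : finFieldType) (V : vectType F).
Implicit Types (A B T X Y : {vspace V}) (R : rel {vspace V}).

(** The subspaces of dimension [k] between [A] and [B]. *)
Definition vinterval A B k : pred {vspace V} :=
  fun X => [&& (A <= X)%VS, (X <= B)%VS & \dim X == k].

(** The incidence matrix of [R] between the subspaces of dimensions [k] and
    [l] in the interval from [A] to [B] has trivial kernel on rational functions
    of the subspaces of dimension [k]. *)
Definition incidence_injective A B k l R :=
  forall f : {vspace V} -> rat,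
    (forall Y, vinterval A B l Y -> \sum_(X | vinterval A B k X && R X Y) f X = 0)%R ->
    forall X, vinterval A B k X -> f X = 0%R.

(** Common core of both cases of Kantor's theorem.  Here [t T] is a type of
    subspaces relative to [T]; on dimension [k] it determines
    [dim (X :&: T)]. *)
Lemma incidence_injective_of_type A B k l R (t : {vspace V} -> {vspace V} -> nat) :
  (forall g : 'End(V), lker g == 0%VS -> forall X Y, R (g @: X)%VS (g @: Y)%VS = R X Y) ->
  (forall g : 'End(V), lker g == 0%VS -> forall T Y, (g @: T = T)%VS ->
     t T (g @: Y)%VS = t T Y) ->
  (forall T X X', vinterval A B k T -> vinterval A B k X -> vinterval A B k X' ->
     t T X = t T X' -> \dim (X :&: T) = \dim (X' :&: T)) ->
  (forall T X Y, vinterval A B k T -> vinterval A B k X -> vinterval A B l Y ->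
     R X Y -> t T X <= t T Y) ->
  (forall T X, vinterval A B k T -> vinterval A B k X ->
     exists Y, [/\ vinterval A B l Y, R X Y & t T Y = t T X]) ->
  incidence_injective A B k l R.
Proof.
move=> Rg tg tcap mono exY f f0 T kT.
have sub_type X X' j : vinterval A B k X -> vinterval A B k X' -> t T X = t T X' ->
    #|[set Y | [&& vinterval A B l Y, t T Y == j & R X Y]]| <=
    #|[set Y | [&& vinterval A B l Y, t T Y == j & R X' Y]]|.
  move=> kX kX' tX.
  have eD := tcap _ _ _ kT kX kX' tX.
  case/and3P: (kT) => AT TB _.
  case/and3P: kX => AX XB /eqP dX; case/and3P: kX' => AX' XB' /eqP dX'.
  have [||||||g [g0 gA gB gT gX]] := @move_subspace _ _ A B T X X'.
  - by rewrite subv_cap AX.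
  - by rewrite subv_cap AX'.
  - by rewrite subv_add XB.
  - by rewrite subv_add XB'.
  - by rewrite dX.
  - exact: eD.
  have ginj : injective (fun Y => g @: Y)%VS.
    by move=> Y Z /eqP; rewrite eq_limg_ker0 // => /eqP.
  rewrite -(card_imset _ ginj); apply: subset_leq_card.
  apply/subsetP=> _ /imsetP[Y + ->]; rewrite !inE => /and3P[/and3P[AY YB dY] tY RY].
  rewrite /vinterval -[in (A <= _)%VS]gA -[in (_ <= B)%VS]gB -gX Rg // !limg_ker0 //.
  by rewrite AY YB tg // tY RY limg_dim_eq ?dY // (eqP g0) capv0.
have := @triangular_sums_eq0 _ (vinterval A B k) (vinterval A B l) R (t T) (t T) f.
move=> /(_ _ _ _ f0 (t T T)); rewrite (big_pred1 T); first apply.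
- by move=> X Y; apply: mono.
- by move=> X; apply: exY.
- by move=> X X' j kX kX' e; apply/eqP; rewrite eqn_leq !sub_type.
move=> X /=; apply/andP/eqP => [[kX /eqP tX]|->]; last by rewrite kT.
have := tcap _ _ _ kT kX kT tX; rewrite capvv.
case/and3P: kX => _ _ /eqP dX; case/and3P: kT => _ _ /eqP dT eD.
apply/eqP; rewrite eqEdim dX dT leqnn andbT.
suff <- : (X :&: T = X)%VS by apply: capvSr.
by apply/eqP; rewrite eqEdim capvSl eD dX dT leqnn.
Qed.

Lemma limg_lker0_dim (g : 'End(V)) Y : lker g == 0%VS -> \dim (g @: Y) = \dim Y.
Proof. by move=> /eqP g0; rewrite limg_dim_eq // g0 capv0. Qed.

(** Kantor's theorem.  Given [X] and [T], adding to [X] a part of a complement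
    [K] of [X + T] in [B] leaves the intersection with [T] unchanged; the
    hypothesis on [k + l] says that [K] is large enough. *)
Lemma kantor_up A B k l : k <= l -> k + l <= \dim A + \dim B ->
  incidence_injective A B k l (fun X Y => X <= Y)%VS.
Proof.
move=> kl klAB.
apply: (@incidence_injective_of_type A B k l _ (fun T Y => \dim (Y :&: T))) => //.
- by move=> g g0 X Y; apply: limg_ker0.
- by move=> g g0 T Y gT; rewrite -{1}gT -lker0_img_cap // limg_lker0_dim.
- by move=> T X Y _ _ _ XY; rewrite dimvS // capvS.
move=> T X /and3P[AT TB /eqP dT] /and3P[AX XB /eqP dX].
have SB : (X + T <= B)%VS by rewrite subv_add XB.
pose K := (B :\: (X + T))%VS.
have dK : \dim K = \dim B - \dim (X + T) by apply: dimv_diff.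
have dS := dimv_sum_cap X T.
have dA : \dim A <= \dim (X :&: T) by rewrite dimvS // subv_cap AX.
have dSB := dimvS SB.
have SK : ((X + T) :&: K = 0)%VS by apply: cap_diffv.
have XK : (X :&: K = 0)%VS.
  by apply/eqP; rewrite -subv0 -SK capvS // addvSl.
have dXK := dimv_disjoint_sum XK.
have [||Y [XY YK dY]] := @subspace_between _ _ X (X + K)%VS l.
- exact: addvSl.
- by rewrite dX kl dXK; lia.
exists Y; split=> //.
  apply/and3P; split; [exact: subv_trans AX XY | | exact/eqP].
  by apply: subv_trans YK _; rewrite subv_add XB diffvSl.
have dSK : \dim (X + K + T) = \dim (X + T) + \dim K.
  by rewrite -addvA [(K + T)%VS]addvC addvA dimv_disjoint_sum.
have dSK' := dimv_sum_cap (X + K) T.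
have : \dim (X :&: T) <= \dim (Y :&: T) by rewrite dimvS // capvS.
have : \dim (Y :&: T) <= \dim ((X + K) :&: T) by rewrite dimvS // capvS.
by lia.
Qed.

(** The dual statement; types are measured by the codimension in [B] of the
    sum with [T].  Given [X] and [T], a subspace [Y] of [X] that contains a
    complement [C] of [X :&: T] has [Y + T = X + T]; the hypothesis on [k + l]
    leaves room for such a [Y] above [A + C]. *)
Lemma kantor_down A B k l : l <= k -> \dim A + \dim B <= k + l ->
  incidence_injective A B k l (fun X Y => Y <= X)%VS.
Proof.
move=> lk klAB.
apply: (@incidence_injective_of_type A B k l _ (fun T Y => \dim B - \dim (Y + T))).
- by move=> g g0 X Y; apply: limg_ker0.
- by move=> g g0 T Y gT; rewrite -{1}gT -limgD limg_lker0_dim.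
- move=> T X X' /and3P[AT TB /eqP dT] /and3P[AX XB /eqP dX] /and3P[AX' XB' /eqP dX'].
  have : \dim (X + T) <= \dim B by rewrite dimvS // subv_add XB.
  have : \dim (X' + T) <= \dim B by rewrite dimvS // subv_add XB'.
  have := dimv_sum_cap X T; have := dimv_sum_cap X' T; lia.
- by move=> T X Y _ _ _ XY; rewrite leq_sub2l // dimvS // addvS.
move=> T X /and3P[AT TB /eqP dT] /and3P[AX XB /eqP dX].
pose C := (X :\: T)%VS.
have CX : (C <= X)%VS by apply: diffvSl.
have dS := dimv_sum_cap X T.
have dSB : \dim (X + T) <= \dim B by rewrite dimvS // subv_add XB.
have dC : \dim C + \dim (X :&: T) = \dim X.
  rewrite -dimv_disjoint_sum ?addv_diff_cap //.
  apply/eqP; rewrite -subv0 -(capv_diff X T) capvS //; exact: capvSr.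
have dAC := dimv_sum_cap A C.
have [||Y [ACY YX dY]] := @subspace_between _ _ (A + C)%VS X l.
- by rewrite subv_add AX.
- by apply/andP; split; lia.
move: ACY; rewrite subv_add => /andP[AY CY].
exists Y; split=> //.
  by apply/and3P; split; [| exact: subv_trans YX XB | exact/eqP].
congr (_ - \dim _); apply/eqP; rewrite eqEsubv; apply/andP; split.
  by rewrite addvS.
by rewrite -addv_diff addvS.
Qed.

End Kantor.

(** * Orbits of flags *)

Section Flags.
Variables (F : finFieldType) (V : vectType F).
Implicit Types (A B X Y : {vspace V}) (R : rel {vspace V}).

Local Notation "W .[ j ]" := (nth 0%VS W j).

Lemma FlP r (a : r.-tuple nat) (W : r.+1.-tuple {vspace V}) :
  reflect [/\ W.[0] = 0%VS, W.[r] = fullv &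
    forall j, j < r -> (W.[j] <= W.[j.+1])%VS /\
                       \dim W.[j.+1] = \dim W.[j] + nth 0 a j]
  (W \in Fl V a).
Proof.
rewrite inE; apply: (iffP and3P) => [[/eqP-> /eqP-> /forallP h]|[-> -> h]].
  split=> // j jr; have := h (Ordinal jr).
  by rewrite (tnth_nth 0) /= => /andP[-> /eqP].
split=> //; apply/forallP=> j; have [-> /eqP] := h _ (ltn_ord j).
by rewrite (tnth_nth 0).
Qed.

(** The sequence of subspaces [W] with its term of index [p] replaced by [X]. *)
Definition set_term r (W : r.+1.-tuple {vspace V}) p X : r.+1.-tuple {vspace V} :=
  [tuple if val j == p then X else W.[j] | j < r.+1].

Lemma nth_set_term r (W : r.+1.-tuple {vspace V}) p X j : j <= r ->
  (set_term W p X).[j] = if j == p then X else W.[j].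
Proof. by move=> jr; rewrite -(tnth_nth _ _ (Ordinal (jr : j < r.+1))) tnth_mktuple. Qed.

(** If [a] and [c] agree up to a redistribution between positions [i] and
    [i.+1], then replacing the term [i.+1] of a flag of type [a] by [X] gives a
    flag of type [c] exactly when [X] lies between the neighbouring terms and has
    the right dimension. *)
Lemma set_term_Fl r (a c : r.-tuple nat) (W : r.+1.-tuple {vspace V}) i X :
  i.+1 < r -> (forall j, j != i -> j != i.+1 -> nth 0 c j = nth 0 a j) ->
  nth 0 c i + nth 0 c i.+1 = nth 0 a i + nth 0 a i.+1 ->
  W \in Fl V a ->
  (set_term W i.+1 X \in Fl V c) =
  vinterval W.[i] W.[i.+2] (\dim W.[i] + nth 0 c i) X.
Proof.
move=> ir eca esum /FlP[W0 Wr Wj].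
have [W1 d1] := Wj i (ltnW ir); have [W2 d2] := Wj _ ir.
apply/FlP/and3P => [[_ _ h]|[AX XB /eqP dX]].
  have := h _ ir; have := h i (ltnW ir).
  rewrite !nth_set_term ?(ltnW ir) ?(ltnW (ltnW ir)) // eqxx.
  by rewrite (ltn_eqF (ltnSn i)) (gtn_eqF (ltnSn i.+1)) => -[-> ->] [-> _].
split.
- by rewrite nth_set_term.
- by rewrite nth_set_term // (gtn_eqF ir).
move=> j jr; rewrite !nth_set_term ?(ltnW jr) // eqSS.
have [->|ji] := eqVneq j i.
  by rewrite (ltn_eqF (ltnSn i)) AX dX.
have [->|ji1] := eqVneq j i.+1.
  by split=> //; rewrite d2 d1 dX -!addnA esum.
by rewrite eca //; apply: Wj.
Qed.

Variables (G : groupType) (rho : G -> 'End(V)).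
Hypothesis rhoP : linear_action rho.

Lemma linear_action_lker0 g : lker (rho g) == 0%VS.
Proof.
case: rhoP => rho1 rhoM; apply/lker0P => u v euv.
have rhoK w : rho g^-1%g (rho g w) = w.
  by rewrite -comp_lfunE -rhoM mulVg rho1 id_lfunE.
by rewrite -[u]rhoK euv rhoK.
Qed.

Lemma nth_flag_act r g (W : r.+1.-tuple {vspace V}) j : j <= r ->
  (flag_act rho g W).[j] = (rho g @: W.[j])%VS.
Proof. by move=> jr; rewrite (nth_map 0%VS) // size_tuple. Qed.

Lemma flag_act1 r (W : r.+1.-tuple {vspace V}) : flag_act rho 1%g W = W.
Proof.
apply/val_inj/(@eq_from_nth _ 0%VS) => [|j]; first by rewrite !size_tuple.
rewrite [X in j < X]size_tuple => jr.
by rewrite nth_flag_act // rhoP.1 lim1g.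
Qed.

Lemma flag_actM r g h (W : r.+1.-tuple {vspace V}) :
  flag_act rho (g * h)%g W = flag_act rho g (flag_act rho h W).
Proof.
apply/val_inj/(@eq_from_nth _ 0%VS) => [|j]; first by rewrite !size_tuple.
rewrite [X in j < X]size_tuple => jr.
by rewrite !nth_flag_act // rhoP.2 limg_comp.
Qed.

Lemma flag_act_Fl r (a : r.-tuple nat) g W : W \in Fl V a -> flag_act rho g W \in Fl V a.
Proof.
move=> /FlP[W0 Wr Wj]; apply/FlP; split.
- by rewrite nth_flag_act // W0 limg0.
- by rewrite nth_flag_act // Wr lker0_limgf // linear_action_lker0.
move=> j jr; have [leW dW] := Wj j jr.
by rewrite !nth_flag_act ?(ltnW jr) // limgS // !limg_lker0_dim ?linear_action_lker0.
Qed.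

(** The incidence matrix between flags of types [a] and [b] that agree away
    from the term [i.+1] is block diagonal, with one block for each choice of
    the other terms; so its injectivity follows from that of the blocks. *)
Lemma leq_num_orbits_incidence r (a b : r.-tuple nat) i R :
  i.+1 < r -> (forall j, j != i -> j != i.+1 -> nth 0 b j = nth 0 a j) ->
  nth 0 b i + nth 0 b i.+1 = nth 0 a i + nth 0 a i.+1 ->
  (forall g : 'End(V), lker g == 0%VS ->
     forall X Y, R X Y -> R (g @: X)%VS (g @: Y)%VS) ->
  (forall A B, \dim B = \dim A + (nth 0 a i + nth 0 a i.+1) ->
     incidence_injective A B (\dim A + nth 0 a i) (\dim A + nth 0 b i) R) ->
  num_orbits (flag_act rho (r:=r)) (Fl V a) <= num_orbits (flag_act rho (r:=r)) (Fl V b).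
Proof.
move=> ir eba esum Rg Rinj.
pose RF (W W' : r.+1.-tuple {vspace V}) :=
  [forall j : 'I_r.+1, (val j != i.+1) ==> (W.[j] == W'.[j])] && R W.[i.+1] W'.[i.+1].
apply: (@leq_num_orbits _ _ _ (@flag_act1 r) (@flag_actM r) _ _ RF).
- by move=> g W; apply: flag_act_Fl.
- move=> g W W' /andP[/forallP eW RW]; apply/andP; split; last first.
    by rewrite !nth_flag_act ?(ltnW ir) // Rg // linear_action_lker0.
  apply/forallP=> j; apply/implyP=> /(implyP (eW j)) /eqP e.
  by rewrite !nth_flag_act ?e // -ltnS.
move=> f f0 /= W Wa.
have [_ _ Wj] := FlP _ _ Wa.
have [W1 d1] := Wj i (ltnW ir); have [W2 d2] := Wj _ ir.
have setK (W' : r.+1.-tuple {vspace V}) :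
    (forall j : 'I_r.+1, val j != i.+1 -> W'.[j] = W.[j]) ->
    set_term W i.+1 W'.[i.+1] = W'.
  move=> eW; apply/val_inj/(@eq_from_nth _ 0%VS) => [|j]; first by rewrite !size_tuple.
  rewrite [X in j < X]size_tuple => jr; rewrite nth_set_term //.
  by case: eqVneq => [->//|ji]; rewrite (eW (Ordinal jr)).
have set_same X : (set_term W i.+1 X).[i.+1] = X.
  by rewrite nth_set_term ?eqxx // ltnW.
rewrite -[W]setK //.
apply: (Rinj W.[i] W.[i.+2] _ (fun X => f (set_term W i.+1 X))); last first.
- by apply/and3P; split; rewrite ?d1.
- move=> Y kY; have Yb : set_term W i.+1 Y \in Fl V b.
    by rewrite (set_term_Fl _ ir eba esum Wa).
  rewrite -[RHS](f0 _ Yb).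
  rewrite [RHS](reindex_onto (set_term W i.+1) (fun W' => W'.[i.+1])) /=.
    apply: eq_bigl => X; rewrite (@set_term_Fl r a a) // /RF !set_same eqxx andbT.
    congr (_ && _); rewrite [X in X && _](_ : _ = true) //.
    apply/forallP=> j; apply/implyP=> ji.
    by rewrite !nth_set_term ?leq_ord // (negPf ji).
  move=> W' /andP[_ /andP[/forallP eW _]]; apply: setK => j ji.
  by have /implyP /(_ ji) /eqP -> := eW j; rewrite nth_set_term ?leq_ord // (negPf ji).
- by rewrite d2 d1 addnA.
Qed.

(** Kantor's theorem applies upwards when the term [i] of [a] is the smaller
    of the two, and downwards when the term [i.+1] is. *)
Lemma leq_num_orbits_adjacent r (a b : r.-tuple nat) i :
  i.+1 < r -> (forall j, j != i -> j != i.+1 -> nth 0 b j = nth 0 a j) ->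
  nth 0 a i + nth 0 a i.+1 = nth 0 b i + nth 0 b i.+1 ->
  minn (nth 0 a i) (nth 0 a i.+1) <= minn (nth 0 b i) (nth 0 b i.+1) ->
  num_orbits (flag_act rho (r:=r)) (Fl V a) <= num_orbits (flag_act rho (r:=r)) (Fl V b).
Proof.
move=> ir eba esum lemin; have [le_a|/ltnW le_a] := leqP (nth 0 a i) (nth 0 a i.+1).
  apply: (@leq_num_orbits_incidence r a b i (fun X Y => X <= Y)%VS) => //.
    by move=> g g0 X Y XY; rewrite limgS.
  by move=> A B dB; apply: kantor_up; lia.
apply: (@leq_num_orbits_incidence r a b i (fun X Y => Y <= X)%VS) => //.
  by move=> g g0 X Y XY; rewrite limgS.
by move=> A B dB; apply: kantor_down; lia.
Qed.

Lemma leq_num_orbits_smoothing r (a b : r.-tuple nat) : smoothing a b ->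
  num_orbits (flag_act rho (r:=r)) (Fl V a) <= num_orbits (flag_act rho (r:=r)) (Fl V b).
Proof.
move: {2}(tval a) (erefl (tval a)) => s ea; move: {2}(tval b) (erefl (tval b)) => t eb.
rewrite ea eb => sm; elim: sm a ea b eb => {s t}.
  by move=> s a ea b eb; rewrite (_ : a = b) //; apply: val_inj; rewrite /= ea eb.
move=> p x y x' y' q t exy lemin _ IH a ea b eb.
have sz : size (p ++ x' :: y' :: q) == r by rewrite -(size_tuple a) ea !size_cat.
apply: leq_trans (IH (Tuple sz) erefl b eb).
have ir : (size p).+1 < r by rewrite -(eqP sz) size_cat /=; lia.
have at0 u v : nth 0 (p ++ u :: v :: q) (size p) = u by rewrite nth_cat ltnn subnn.
have at1 u v : nth 0 (p ++ u :: v :: q) (size p).+1 = v.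
  by rewrite nth_cat ltnNge leqnSn subSnn.
apply: (@leq_num_orbits_adjacent r _ _ (size p)) => //=; rewrite ea ?at0 ?at1 //.
move=> j j0 j1; rewrite !nth_cat; case: ltnP => // pj.
have [k ->] : exists k, j - size p = k.+2 by exists (j - size p).-2; lia.
by [].
Qed.

End Flags.

Theorem mainTheorem8 (F : finFieldType) (V : vectType F) (n : nat)
    (hn : 1 <= n) (hV : \dim {:V} = n)
    (G : groupType) (rho : G -> 'End(V)) (hrho : linear_action rho)
    (r : nat) (hr : 1 <= r) (a b : r.-tuple nat)
    (ha : composition n a) (hb : composition n b)
    (hdom : dominates (partition_of a) (partition_of b)) :
  num_orbits (flag_act rho (r:=r)) (Fl V a) <= num_orbits (flag_act rho (r:=r)) (Fl V b).
Proof. exact/leq_num_orbits_smoothing/(dominates_smoothing ha hb hdom). Qed.
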